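(* Consider $6$-colourings of the $3\times3$-block with vertices $v_1,\dots,v_9$ and boundary vertices $z_1,\dots,z_{12}$. (a) If the boundary is labelled so that $z_1$ is adjacent to the corner vertex $v_1$, then $p^{\mathrm{low}}_{v_1}\ge 0.3537$, $p^{\mathrm{low}}_{v_3}\ge 0.0245$, $p^{\mathrm{low}}_{v_7}\ge 0.0245$ and $p^{\mathrm{low}}_{v_9}\ge 0.0071$. (b) If the boundary is labelled so that $z_1$ is adjacent to the middle vertex $v_2$ of the first row, then $p^{\mathrm{low}}_{v_1}\ge 0.0838$, $p^{\mathrm{low}}_{v_3}\ge 0.0838$, $p^{\mathrm{low}}_{v_7}\ge 0.0138$ and $p^{\mathrm{low}}_{v_9}\ge 0.0138$.
   Context: The block is a $3\times3$ sub-grid of the square lattice whose vertices are labelled row by row: first row $v_1,v_2,v_3$, second row $v_4,v_5,v_6$, third row $v_7,v_8,v_9$; horizontally or vertically neighbouring block vertices are adjacent. The boundary consists of the twelve lattice vertices $z_1,\dots,z_{12}$ outside the block that are adjacent to some block vertex; each corner $v_1,v_3,v_7,v_9$ is adjacent to exactly two boundary vertices, each of $v_2,v_4,v_6,v_8$ is adjacent to exactly one, $v_5$ to none, and each boundary vertex is adjacent to exactly one block vertex. The position of $z_1$ is as specified in (a) or (b) (how $z_2,\dots,z_{12}$ are labelled is immaterial). A boundary colouring is any function $Z:\{z_1,\dots,z_{12}\}\to\{1,\dots,6\}$. A proper $6$-colouring of the block agrees with $Z$ if adjacent block vertices have different colours and each block vertex has a colour different from the colours under $Z$ of its adjacent boundary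 vertices. Let $\pi_Z$ be the uniform distribution on the proper $6$-colourings of the block that agree with $Z$. For boundary colourings $Z,Z'$ and a coupling $\Psi$ of $\pi_Z$ and $\pi_{Z'}$, let $p_{v}(\Psi)$ be the probability that the colour of block vertex $v$ differs in the pair of colourings drawn from $\Psi$. Define $$p^{\mathrm{low}}_{v}=\max_{Z,Z'}\ \min_{\Psi}\ p_{v}(\Psi),$$ where the maximum is over all pairs $Z,Z'$ of boundary colourings that agree on every boundary vertex except $z_1$, on which they differ, and the minimum is over all couplings $\Psi$ of $\pi_Z$ and $\pi_{Z'}$. *)

(* Defs.v *)
From HB Require Import structures.
From mathcomp Require Import all_boot all_order all_algebra.
From mathcomp Require Import classical_sets reals.

Set Implicit Arguments.
Unset Strict Implicit.
Unset Printing Implicit Defensive.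

Import Order.TTheory GRing.Theory Num.Theory.

Local Open Scope ring_scope.

(* Vertices of the square lattice are given by (row, column) coordinates,
   chosen so that the block occupies rows and columns 1, 2, 3; all its
   neighbours then have coordinates in {0, ..., 4}. *)
Definition lattice_adj (p q : nat * nat) : bool :=
  ((p.1 == q.1) && ((p.2 == q.2.+1) || (q.2 == p.2.+1))) ||
  ((p.2 == q.2) && ((p.1 == q.1.+1) || (q.1 == p.1.+1))).

(* The element i of 'I_9 is the block vertex v_(i+1), numbered row by row. *)
Definition block := 'I_9.

Definition block_pos (v : block) : nat * nat := ((v %/ 3).+1, (v %% 3).+1)%N.

Definition v1 : block := @Ordinal 9 0 isT.
Definition v2 : block := @Ordinal 9 1 isT.
Definition v3 : block := @Ordinal 9 2 isT.
Definition v7 : block := @Ordinal 9 6 isT.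
Definition v9 : block := @Ordinal 9 8 isT.

Definition window_pos (p : 'I_5 * 'I_5) : nat * nat :=
  (nat_of_ord p.1, nat_of_ord p.2).

Definition on_boundary (p : 'I_5 * 'I_5) : bool :=
  [forall v : block, window_pos p != block_pos v] &&
  [exists v : block, lattice_adj (window_pos p) (block_pos v)].

Definition boundary := {p : 'I_5 * 'I_5 | on_boundary p}.

Definition block_adj (v w : block) : bool :=
  lattice_adj (block_pos v) (block_pos w).

Definition boundary_adj (z : boundary) (v : block) : bool :=
  lattice_adj (window_pos (val z)) (block_pos v).

Definition colour := 'I_6.

Definition boundary_colouring := {ffun boundary -> colour}.

Definition block_colouring := {ffun block -> colour}.

Definition agreeing (Z : boundary_colouring) : {set block_colouring} :=
  [set x : block_colouring |
    [forall v : block, forall w : block, block_adj v w ==> (x v != x w)] &&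
    [forall z : boundary, forall v : block,
       boundary_adj z v ==> (x v != Z z)]].

(* Probability mass function of the uniform distribution on agreeing Z, which
   is never empty: every vertex of the block has only four neighbours. *)
Definition unif_agreeing (R : realType) (Z : boundary_colouring)
    (x : block_colouring) : R :=
  if x \in agreeing Z then #|agreeing Z|%:R^-1 else 0.

Definition is_coupling (R : realType) (mu nu : block_colouring -> R)
    (Psi : block_colouring * block_colouring -> R) : Prop :=
  [/\ forall xy, 0 <= Psi xy,
      forall x, \sum_(y : block_colouring) Psi (x, y) = mu x
    & forall y, \sum_(x : block_colouring) Psi (x, y) = nu y].

Definition p_diff (R : realType) (v : block)
    (Psi : block_colouring * block_colouring -> R) : R :=
  \sum_(xy : block_colouring * block_colouring | xy.1 v != xy.2 v) Psi xy.

(* The couplings form a nonempty compact polytope on which p_diff v is linear,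
   so this infimum is a minimum. *)
Definition p_min (R : realType) (v : block) (Z Z' : boundary_colouring) : R :=
  inf [set p_diff v Psi | Psi in
        [set Psi | is_coupling (@unif_agreeing R Z) (@unif_agreeing R Z') Psi]]
      %classic.

Definition differ_only_at (z1 : boundary) (Z Z' : boundary_colouring) : bool :=
  (Z z1 != Z' z1) && [forall z : boundary, (z != z1) ==> (Z z == Z' z)].

(* The default value 0 of the maximum is harmless: such pairs exist and p_min
   is nonnegative. *)
Definition p_low (R : realType) (z1 : boundary) (v : block) : R :=
  \big[Num.max/0]_(ZZ : boundary_colouring * boundary_colouring |
                     differ_only_at z1 ZZ.1 ZZ.2) p_min R v ZZ.1 ZZ.2.

(* Main.v *)
(* A coupling of two distributions lets v differ with probability at least
   mu (x v \in S) - nu (x v \in S), for every set S of colours. Each bound thus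
   follows from one pair of boundary colourings, which differ only at z_1, and
   one set S, through a count of list colourings of the block. The pairs in the
   proof of the theorem come from a hill-climbing search. *)
Require Import Defs.
From HB Require Import structures.
From Stdlib Require Import NArith.
From mathcomp Require Import all_boot all_order all_algebra zify.
From mathcomp Require Import classical_sets reals.

Set Implicit Arguments.
Unset Strict Implicit.
Unset Printing Implicit Defensive.

Import Order.TTheory GRing.Theory Num.Theory.

Local Open Scope ring_scope.

(** * Couplings and lower bounds for [p_low] *)

Lemma ler_p_min (R : realType) v (Z Z' : boundary_colouring) (a : R) :
  (0 < #|agreeing Z|)%N -> (0 < #|agreeing Z'|)%N ->
  (forall Psi, is_coupling (@unif_agreeing R Z) (@unif_agreeing R Z') Psi ->
     a <= p_diff v Psi) ->
  a <= p_min R v Z Z'.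
Proof.
move=> Z0 Z'0 le_a; apply: lb_le_inf; last by move=> _ [Psi /le_a ? <-].
have sum_unif W : (0 < #|agreeing W|)%N -> \sum_x unif_agreeing R W x = 1.
  move=> W0; rewrite /unif_agreeing -big_mkcond /= sumr_const.
  by rewrite -[_ *+ _]mulr_natr mulVf // pnatr_eq0 -lt0n.
(* The infimum is over a nonempty set: the product of the two uniform distributions is a
   coupling. *)
exists (p_diff v (fun xy => unif_agreeing R Z xy.1 * unif_agreeing R Z' xy.2)).
exists (fun xy => unif_agreeing R Z xy.1 * unif_agreeing R Z' xy.2) => //.
have unif_ge0 W x : 0 <= unif_agreeing R W x.
  by rewrite /unif_agreeing; case: ifP => // _; rewrite invr_ge0 ler0n.
split=> [xy | x | y] /=; first by rewrite mulr_ge0.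
- by rewrite -mulr_sumr sum_unif // mulr1.
- by rewrite -mulr_suml sum_unif // mul1r.
Qed.

(** For every pair, the indicator of [S (x v)] is at most that of [S (y v)] plus that of
    [x v != y v]. Summing against [Psi] turns the first two into the marginals [mu] and [nu]. *)
Lemma p_diff_ge (R : realType) (mu nu : block_colouring -> R) Psi
    (v : block) (S : pred colour) :
  is_coupling mu nu Psi ->
  \sum_(x : block_colouring | S (x v)) mu x -
  \sum_(y : block_colouring | S (y v)) nu y <= p_diff v Psi.
Proof.
case=> Psi0 muE nuE; rewrite lerBlDr.
have -> : \sum_(x : block_colouring | S (x v)) mu x =
    \sum_(xy : block_colouring * block_colouring | S (xy.1 v)) Psi xy.
  under eq_bigr do rewrite -muE.
  by rewrite pair_big_dep /=; apply: eq_big => [[]|[]] //= *; rewrite andbT.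
have -> : \sum_(y : block_colouring | S (y v)) nu y =
    \sum_(xy : block_colouring * block_colouring | S (xy.2 v)) Psi xy.
  under eq_bigr do rewrite -nuE.
  by rewrite exchange_big pair_big_dep /=; apply: eq_big => [[]|[]].
rewrite /p_diff big_mkcond [X in _ <= X + _]big_mkcond.
rewrite [X in _ <= _ + X]big_mkcond -big_split /=.
apply: ler_sum => -[x y] _ /=; have [-> | _] := eqVneq (x v) (y v).
  by rewrite add0r.
by do 2?case: ifP => _; rewrite ?addr0 ?lerDl ?addr_ge0.
Qed.

Lemma sum_unif_agreeing (R : realType) Z (v : block) (S : pred colour) :
  \sum_(x : block_colouring | S (x v)) unif_agreeing R Z x =
  #|[set x in agreeing Z | S (x v)]|%:R / #|agreeing Z|%:R.
Proof.
rewrite /unif_agreeing -big_mkcondr /= sumr_const -[LHS]mulr_natl.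
by congr (_%:R / _); apply: eq_card => x; rewrite [RHS]inE [RHS]andbC.
Qed.

Lemma p_low_ge (R : realType) z1 (v : block) Z Z' (S : pred colour) (a : R) :
  differ_only_at z1 Z Z' -> (0 < #|agreeing Z|)%N -> (0 < #|agreeing Z'|)%N ->
  a <= #|[set x in agreeing Z | S (x v)]|%:R / #|agreeing Z|%:R
       - #|[set x in agreeing Z' | S (x v)]|%:R / #|agreeing Z'|%:R ->
  a <= p_low R z1 v.
Proof.
move=> dZ Z0 Z'0 le_a.
apply: le_trans (le_bigmax_cond _ (fun ZZ => p_min R v ZZ.1 ZZ.2)
  (j := (Z, Z')) dZ).
apply: ler_p_min => // Psi /(p_diff_ge v S).
by apply: le_trans; rewrite !sum_unif_agreeing.
Qed.

(** * Counting list colourings of the block *)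

Lemma nat_of_bin_mul m n : nat_of_bin (m * n)%num = (m * n)%N.
Proof. lia. Qed.

(** Values are binary because the counts are evaluated by [vm_compute]. *)
Definition sumN (s : seq nat) (F : nat -> N) : N :=
  foldr (fun c n => (F c + n)%num) 0%num s.

Lemma sumNE (P : pred nat) n (F : nat -> N) :
  nat_of_bin (sumN [seq c <- iota 0 n | P c] F) =
  (\sum_(c < n | P c) nat_of_bin (F c))%N.
Proof.
rewrite -(big_mkord P (fun c => nat_of_bin (F c))) -big_filter.
rewrite /index_iota subn0.
elim: [seq _ <- _ | _] => [|c s IHs] /=; first by rewrite big_nil.
by rewrite big_cons -IHs; lia.
Qed.

(** [a], [b], [c] are the colours of the middle row; the counted row is the top or the bottom one,
    with lists [L1], [L2], [L3]. *)
Definition row_count (L1 L2 L3 : seq nat) (a b c : nat) : N :=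
  sumN [seq x <- L1 | x != a] (fun x =>
  sumN [seq y <- L2 | (y != b) && (y != x)] (fun y =>
  sumN [seq z <- L3 | (z != c) && (z != y)] (fun=> 1%num))).

(* Once the colours of the middle row are fixed, the colourings of the top row
   and of the bottom row are independent. *)
Definition grid_count (L : nat -> seq nat) : N :=
  let top := row_count (L 0) (L 1) (L 2) in
  let bottom := row_count (L 6) (L 7) (L 8) in
  sumN (L 3) (fun a =>
  sumN [seq b <- L 4 | b != a] (fun b =>
  sumN [seq c <- L 5 | c != b] (fun c => top a b c * bottom a b c)%num)).

Notation row3 := (colour * colour * colour)%type.

Definition row_proper (P1 P2 P3 : pred nat) (r : row3) :=
  [&& P1 r.1.1, P2 r.1.2, P3 r.2, r.1.2 != r.1.1 & r.2 != r.1.2].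

Definition rows_proper (r s : row3) :=
  [&& r.1.1 != s.1.1, r.1.2 != s.1.2 & r.2 != s.2].

(** A sum of ones rather than a cardinal, so that the product of the top and bottom counts expands
    by distributivity. *)
Lemma row_countE (P1 P2 P3 : pred nat) (s : row3) :
  nat_of_bin (row_count [seq c <- iota 0 6 | P1 c] [seq c <- iota 0 6 | P2 c]
    [seq c <- iota 0 6 | P3 c] s.1.1 s.1.2 s.2) =
  (\sum_(r | row_proper P1 P2 P3 r && rows_proper r s) 1)%N.
Proof.
rewrite /row_count -filter_predI sumNE.
under [LHS]eq_bigr => x _.
  rewrite -filter_predI sumNE.
  under eq_bigr => y _ do rewrite -filter_predI sumNE.
  over.
rewrite pair_big_dep pair_big_dep /=; apply: eq_bigl => -[[x y] z] /=.
rewrite /row_proper /rows_proper /= -!val_eqE /=.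
by do !case: (_ != _); case: (P1 _) (P2 _) (P3 _) => [] [] [].
Qed.

Lemma grid_countE (P : nat -> pred nat) :
  nat_of_bin (grid_count (fun i => [seq c <- iota 0 6 | P i c])) =
  #|[set g : row3 * (row3 * row3) |
     [&& row_proper (P 3) (P 4) (P 5) g.1,
         row_proper (P 0) (P 1) (P 2) g.2.1, rows_proper g.2.1 g.1,
         row_proper (P 6) (P 7) (P 8) g.2.2 & rows_proper g.2.2 g.1]]|.
Proof.
rewrite /grid_count; lazy beta zeta; rewrite sumNE.
under [LHS]eq_bigr => a _.
  rewrite -filter_predI sumNE.
  under eq_bigr => b _.
    rewrite -filter_predI sumNE.
    under eq_bigr => c _.
      (* The product of the two row counts becomes one sum over pairs of a top and a bottom row. *)
      rewrite nat_of_bin_mul (row_countE _ _ _ (a, b, c)).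
      rewrite (row_countE _ _ _ (a, b, c)) big_distrlr /= pair_big.
      over.
    over.
  over.
rewrite pair_big_dep pair_big_dep /= pair_big_dep /= -sum1_card.
apply: eq_bigl => -[[[a b] c] [r s]]; rewrite inE /=.
rewrite /row_proper /= -!val_eqE /=.
by do 3!case: (P _ _) => //=; do 2!case: (_ != _) => //=; rewrite ?andbA ?andbF.
Qed.

(** The middle row comes first, as in the order of summation of [grid_count]. *)
Definition stack (g : row3 * (row3 * row3)) : block_colouring :=
  let: (m, (t, b)) := g in
  [ffun v : block => nth ord0
     [:: t.1.1; t.1.2; t.2; m.1.1; m.1.2; m.2; b.1.1; b.1.2; b.2] v].

Lemma stack_bij : bijective stack.
Proof.
pose r (x : block_colouring) i : row3 :=
  (x (inord i), x (inord i.+1), x (inord i.+2)).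
exists (fun x => (r x 3, (r x 0, r x 6))) => [|x].
  by move=> [[[? ?] ?] [[[? ?] ?] [[? ?] ?]]]; rewrite /r !ffunE !inordK.
apply/ffunP=> v; rewrite ffunE /r /= -{2}[v]inord_val.
by case: v => -[|[|[|[|[|[|[|[|[|//]]]]]]]]] lt_v9.
Qed.

Definition list_colourings (P : nat -> pred nat) : {set block_colouring} :=
  [set x : block_colouring |
    [forall v : block, forall w : block, block_adj v w ==> (x v != x w)] &&
    [forall v : block, P v (x v)]].

Lemma card_list_colourings (P : nat -> pred nat) :
  #|list_colourings P| =
  grid_count (fun i => [seq c <- iota 0 6 | P i c]).
Proof.
rewrite grid_countE -(on_card_preimset (f := stack)); last first.
  exact: onW_bij stack_bij.
apply: eq_card => -[[[x4 x5] x6] [[[x1 x2] x3] [[x7 x8] x9]]]; rewrite !inE.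
rewrite /row_proper /rows_proper /=.
apply/idP/idP.
  case/andP=> /forallP E /forallP A.
  (* [e i j] puts vertex [j] on the left of the inequality, the orientation of [row_proper] and
     [rows_proper]; the twelve edges of the block follow. *)
  have e i j (ltj : (j < 9)%N) (lti : (i < 9)%N) :=
    implyP (forallP (E (Ordinal ltj)) (Ordinal lti)).
  have a i (lti : (i < 9)%N) := A (Ordinal lti).
  have := (e 0 1 isT isT isT, e 1 2 isT isT isT, e 3 4 isT isT isT,
    e 4 5 isT isT isT, e 6 7 isT isT isT, e 7 8 isT isT isT).
  have := (e 3 0 isT isT isT, e 4 1 isT isT isT, e 5 2 isT isT isT,
    e 3 6 isT isT isT, e 4 7 isT isT isT, e 5 8 isT isT isT).
  have := (a 0 isT, a 1 isT, a 2 isT, a 3 isT, a 4 isT,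
    a 5 isT, a 6 isT, a 7 isT, a 8 isT).
  by rewrite !ffunE /= => Pc ne_col ne_row; rewrite !Pc !ne_col !ne_row.
case/and5P=> /and5P[P4 P5 P6 ? ?] /and5P[P1 P2 P3 ? ?] /and3P[? ? ?].
case/and5P=> P7 P8 P9 ? ? /and3P[? ? ?]; apply/andP; split.
  apply/forallP=> -[i lti]; apply/forallP=> -[j ltj].
  rewrite !ffunE; apply/implyP.
  (* All 81 pairs are evaluated: nonadjacent ones are vacuous, and edges met in the other
     orientation need [eq_sym]. *)
  move: i lti j ltj => [|[|[|[|[|[|[|[|[|//]]]]]]]]] lti;
    by move=> [|[|[|[|[|[|[|[|[|//]]]]]]]]] ltj //= _; rewrite // eq_sym.
apply/forallP=> -[i lti]; rewrite ffunE /=.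
by move: i lti => [|[|[|[|[|[|[|[|[|//]]]]]]]]].
Qed.

(** * Boundary colourings as lists of colours *)

(* Positions 0 and 1 are next to v_1, position 2 is next to v_2. *)
Definition ring_pos : seq (nat * nat) :=
  [:: (0, 1); (1, 0); (0, 2); (0, 3); (1, 4); (2, 0);
      (2, 4); (3, 0); (4, 1); (4, 2); (4, 3); (3, 4)]%N.

Lemma on_boundaryE p : on_boundary p = (window_pos p \in ring_pos).
Proof.
apply/idP/idP => [/andP[/forallP off /existsP[v]] | p_ring].
(* If the point (i, j) lies in the block, this is the index of the block vertex there, which
   contradicts [off]; the remaining window points outside [ring_pos] have no neighbour in the
   block. *)
- case: p off v => [[i lti] [j ltj]] /(_ (inord (3 * i.-1 + j.-1))).
  rewrite /block_pos => off [v ltv].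
  move: i lti j ltj v ltv off => [|[|[|[|[|//]]]]] ? [|[|[|[|[|//]]]]] ?;
    first [by rewrite inordK | by move=> [|[|[|[|[|[|[|[|[|//]]]]]]]]] ?].
- apply/andP; split.
    apply/forallP=> -[v ltv]; apply: contraL p_ring => /eqP ->.
    by move: v ltv => [|[|[|[|[|[|[|[|[|//]]]]]]]]].
  suff /hasP[v]: has (fun v =>
      lattice_adj (window_pos p) ((v %/ 3).+1, (v %% 3).+1)) (iota 0 9).
    rewrite mem_iota => /= ltv adj_v; apply/existsP; exists (Ordinal ltv).
    exact: adj_v.
  by move: (window_pos p) p_ring; apply/allP.
Qed.

Definition boundary_of (w : seq nat) : boundary_colouring :=
  [ffun z : boundary => inZp (nth 0%N w (index (window_pos (val z)) ring_pos))].

(** The reduction modulo 6 mirrors [inZp] in [boundary_of]. *)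
Definition forbidden (w : seq nat) (v : nat) : seq nat :=
  [seq (nth 0 w (index q ring_pos) %% 6)%N
  | q <- ring_pos & lattice_adj q ((v %/ 3).+1, (v %% 3).+1)].

(** A fixed boundary acts on the block only by deleting colours from the list of each vertex. *)
Lemma agreeing_boundary_of w :
  agreeing (boundary_of w) =
  list_colourings (fun v c => c \notin forbidden w v).
Proof.
apply/setP=> x; rewrite !inE; congr (_ && _).
apply/forallP/forallP => [ok v | ok z].
  apply/mapP=> -[q]; rewrite mem_filter => /andP[adj_qv q_ring] xE.
  have [lt1 lt2] : (q.1 < 5 /\ q.2 < 5)%N.
    by apply/andP; move: q q_ring {adj_qv xE}; apply/allP.
  have posE : window_pos (Ordinal lt1, Ordinal lt2) = q.
    by rewrite [RHS]surjective_pairing.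
  have on_q : on_boundary (Ordinal lt1, Ordinal lt2).
    by rewrite on_boundaryE posE.
  have /forallP/(_ v)/implyP := ok (Sub _ on_q).
  rewrite /boundary_adj /= posE => /(_ adj_qv) /eqP; apply.
  by apply: val_inj; rewrite ffunE /= posE.
apply/forallP=> v; apply/implyP=> adj_zv; apply: contra (ok v) => /eqP ->.
apply/mapP; exists (window_pos (val z)); last by rewrite ffunE.
by rewrite mem_filter -on_boundaryE (valP z) andbT.
Qed.

(** The entries of [ring_pos] are distinct and cover the boundary, so overwriting entry [k]
    recolours [z1] alone. *)
Lemma differ_only_at_set_nth z1 w k c :
  window_pos (val z1) = nth (0, 0)%N ring_pos k -> (k < 12)%N ->
  (nth 0 w k != c %[mod 6])%N ->
  differ_only_at z1 (boundary_of w) (boundary_of (set_nth 0%N w k c)).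
Proof.
move=> z1E ltk12 neq_c.
have idx_z1 : index (window_pos (val z1)) ring_pos = k.
  by rewrite z1E index_uniq.
apply/andP; split.
  by rewrite !ffunE idx_z1 nth_set_nth /= eqxx -val_eqE.
apply/forallP=> z; apply/implyP=> neq_z; rewrite !ffunE nth_set_nth /=.
case: (_ =P k) => [idx_z | _]; last exact: eqxx.
case/negP: neq_z.
have : window_pos (val z) = window_pos (val z1).
  by rewrite z1E -idx_z nth_index // -on_boundaryE (valP z).
rewrite -!val_eqE /=; case: (val z) (val z1) => [i j] [i' j'] [/= ii jj].
by apply/eqP; congr (_, _); apply: val_inj.
Qed.

(** * Computable certificates for the bounds *)

(** The event that [v] has its colour in [S] is encoded by shrinking the list of [v], so
    [grid_count] applies to it as well. *)
Definition count_boundary (w : seq nat) (v : nat) (S : seq nat) : N :=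
  grid_count (fun u => [seq c <- iota 0 6
                       | (c \notin forbidden w u) && ((u == v) ==> (c \in S))]).

Lemma card_agreeing_in w (v : block) S :
  #|[set x in agreeing (boundary_of w) | val (x v) \in S]| =
  count_boundary w v S.
Proof.
rewrite -card_list_colourings agreeing_boundary_of.
apply: eq_card => x; rewrite !inE -andbA; congr (_ && _).
apply/andP/forallP => [[/forallP ok xvS] u | ok].
  by rewrite ok /=; apply/implyP=> /eqP/val_inj ->.
split; last by have /andP[_ /implyP] := ok v; apply.
by apply/forallP=> u; have /andP[] := ok u.
Qed.

Definition count_agreeing (w : seq nat) : N :=
  grid_count (fun u => [seq c <- iota 0 6 | c \notin forbidden w u]).

Lemma card_agreeing w :
  #|agreeing (boundary_of w)| = count_agreeing w.
Proof. by rewrite agreeing_boundary_of card_list_colourings. Qed.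

(** The second boundary colouring always gives [z1] the colour 1. The last inequality is a / 10000
    <= s / n - s' / n' with denominators cleared. *)
Definition certificate (k : nat) (v : nat) (w S : seq nat) (a : N) : bool :=
  let w' := set_nth 0%N w k 1%N in
  let n := count_agreeing w in
  let n' := count_agreeing w' in
  let s := count_boundary w v S in
  let s' := count_boundary w' v S in
  [&& (k < 12)%N, (nth 0 w k != 1 %[mod 6])%N, (0 <? n)%num, (0 <? n')%num &
    (a * (n * n') + 10000 * (s' * n) <=? 10000 * (s * n'))%num].

Lemma certificate_sound (R : realType) z1 (v : block) k w S (a : nat) :
  window_pos (val z1) = nth (0, 0)%N ring_pos k ->
  certificate k v w S (bin_of_nat a) ->
  a%:R / 10 ^+ 4 <= p_low R z1 v.
Proof.
move=> z1E /and5P[ltk12 neq1 n_gt0 n'_gt0 le_a].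
apply: (p_low_ge (Z := boundary_of w) (Z' := boundary_of (set_nth 0%N w k 1%N))
  (S := fun c => val c \in S)).
- exact: differ_only_at_set_nth.
- by rewrite card_agreeing; lia.
- by rewrite card_agreeing; lia.
rewrite !card_agreeing_in !card_agreeing.
(* The counts become variables; only clearing denominators remains. *)
move: (count_boundary _ _ _) (count_boundary _ _ _) n_gt0 n'_gt0 le_a.
move: (count_agreeing _) (count_agreeing _) => n' n s' s n_gt0 n'_gt0 le_a.
have n0 : 0 < n%:R :> R by rewrite ltr0n; lia.
have n'0 : 0 < n'%:R :> R by rewrite ltr0n; lia.
have e0 : 0 < 10 ^+ 4 :> R by rewrite exprn_gt0.
rewrite lerBrDr addf_div ?gt_eqF // ler_pdivrMr ?mulr_gt0 //.
rewrite mulrAC ler_pdivlMr // -natrX -!natrM -natrD -!natrM ler_nat.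
have -> : (10 ^ 4)%N = nat_of_bin 10000 by [].
have := bin_of_natK a.
move: (bin_of_nat a) le_a => m le_m <-; lia.
Qed.

(** Evaluating the filter leaves positions 0 and 1 for [v1] and position 2 for [v2], so the theorem
    splits into three cases for [z1]. *)
Lemma boundary_adj_nth (z : boundary) (v : block) :
  boundary_adj z v ->
  exists2 k,
    k \in [seq k <- iota 0 12 | lattice_adj (nth (0, 0)%N ring_pos k)
                                      (block_pos v)] &
    window_pos (val z) = nth (0, 0)%N ring_pos k.
Proof.
move=> adj_zv; have z_ring := valP z; rewrite on_boundaryE in z_ring.
exists (index (window_pos (val z)) ring_pos); last by rewrite nth_index.
rewrite mem_filter mem_iota nth_index // [lattice_adj _ _]adj_zv.
by rewrite -[(0 + 12)%N]/(size ring_pos) index_mem.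
Qed.

Theorem lemma8 (R : realType) :
  (forall z1 : boundary, boundary_adj z1 v1 ->
     [/\ 3537 / 10 ^+ 4 <= p_low R z1 v1,
         245 / 10 ^+ 4 <= p_low R z1 v3,
         245 / 10 ^+ 4 <= p_low R z1 v7
       & 71 / 10 ^+ 4 <= p_low R z1 v9]) /\
  (forall z1 : boundary, boundary_adj z1 v2 ->
     [/\ 838 / 10 ^+ 4 <= p_low R z1 v1,
         838 / 10 ^+ 4 <= p_low R z1 v3,
         138 / 10 ^+ 4 <= p_low R z1 v7
       & 138 / 10 ^+ 4 <= p_low R z1 v9]).
Proof.
split=> z1 /boundary_adj_nth[k]; rewrite /= !inE.
  case/orP=> /eqP -> z1E; split.
  (* The first list colours the boundary in the order of [ring_pos], the second is [S]. Here [v1]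
     avoids 0 and 4 under the first colouring, so [S] has probability 1 there, and the difference is
     the probability of colour 0 at [v1] under the second. *)
  - by apply: (@certificate_sound R z1 v1 _
      [:: 0; 4; 0; 5; 2; 0; 4; 3; 2; 1; 5; 3]%N [:: 1; 2; 3; 5]%N 3537 z1E);
      vm_compute.
  - by apply: (@certificate_sound R z1 v3 _
      [:: 0; 4; 4; 3; 4; 0; 0; 0; 3; 3; 0; 5]%N [:: 1; 2; 5]%N 245 z1E);
      vm_compute.
  (* This is the witness for [v3] reflected in the diagonal with colours 2 and 3 exchanged, up to
     the order of the two colours at each corner. *)
  - by apply: (@certificate_sound R z1 v7 _
      [:: 0; 4; 0; 0; 2; 4; 2; 4; 2; 0; 5; 0]%N [:: 1; 3; 5]%N 245 z1E);
      vm_compute.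
  - by apply: (@certificate_sound R z1 v9 _
      [:: 0; 2; 2; 2; 3; 2; 3; 5; 2; 5; 5; 3]%N [:: 1]%N 71 z1E);
      vm_compute.
  (* The two boundary neighbours of v_1 have exchanged their colours. *)
  - by apply: (@certificate_sound R z1 v1 _
      [:: 4; 0; 0; 5; 2; 0; 4; 3; 2; 1; 5; 3]%N [:: 1; 2; 3; 5]%N 3537 z1E);
      vm_compute.
  - by apply: (@certificate_sound R z1 v3 _
      [:: 4; 0; 4; 3; 4; 0; 0; 0; 3; 3; 0; 5]%N [:: 1; 2; 5]%N 245 z1E);
      vm_compute.
  - by apply: (@certificate_sound R z1 v7 _
      [:: 4; 0; 0; 0; 2; 4; 2; 4; 2; 0; 5; 0]%N [:: 1; 3; 5]%N 245 z1E);
      vm_compute.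
  - by apply: (@certificate_sound R z1 v9 _
      [:: 2; 0; 2; 2; 3; 2; 3; 5; 2; 5; 5; 3]%N [:: 1]%N 71 z1E);
      vm_compute.
move/eqP=> -> z1E; split.
(* Colour 0 at [z1] excludes 0 from [v2], which favours 0 at the adjacent corner. *)
- by apply: (@certificate_sound R z1 v1 _
    [:: 4; 3; 0; 0; 1; 0; 3; 2; 0; 3; 3; 0]%N [:: 0]%N 838 z1E);
    vm_compute.
(* Up to renaming colours and reordering the two at each corner, this mirrors the witness for [v1]
   in the middle column; those for [v7] and [v9] are related in the same way. *)
- by apply: (@certificate_sound R z1 v3 _
    [:: 1; 0; 0; 3; 4; 4; 0; 0; 4; 4; 5; 0]%N [:: 0]%N 838 z1E);
    vm_compute.
- by apply: (@certificate_sound R z1 v7 _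
    [:: 4; 5; 0; 1; 0; 4; 1; 4; 2; 2; 1; 3]%N [:: 0; 3; 5]%N 138 z1E);
    vm_compute.
- by apply: (@certificate_sound R z1 v9 _
    [:: 0; 1; 0; 5; 2; 1; 5; 4; 1; 3; 5; 3]%N [:: 0; 2; 4]%N 138 z1E);
    vm_compute.
Qed.
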